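(* Let $K=(K_1^-,K_1^+,\ldots,K_n^-,K_n^+)$ with $K_i^\pm\in\mathbb{R}\cup\{\pm\infty\}$ and $K_i^-\le K_i^+$ for $i=1,\ldots,n$, let $I^{\pm}=\{i\in\{1,\ldots,n\}: K_i^{\pm}\text{ is finite}\}$, and assume $I^+\cap I^-=\emptyset$. Let $h:\mathbb{R}^n\to\mathbb{R}$ be a polynomial with $K$-bounded derivatives over $[-1,1]^n$. Let $\rho\in\{-1,0,1\}^n$ with $\rho_i=1$ (resp. $-1$, $0$) if $K_i^-$ (resp. $K_i^+$, neither) is finite. For $d'\in\mathbb{N}$, define $$\Xi_{d'}(x_1,\ldots,x_n)=\sum_{1\le i\le n}\rho_ix_i+\sum_{1\le i<j\le n}\left(4\rho_ix_i^{2d'+1}+2\rho_jx_i^{2d'}x_j+2\rho_ix_ix_j^{2d'}+4\rho_jx_j^{2d'+1}\right).$$ For any $\epsilon>0$, there exists $d_0'$ such that $h_\epsilon:=h+\epsilon\,\Xi_{d'}$ has sos-$K$-bounded derivatives for all $d'\ge d_0'$.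
   Context: A continuously differentiable function $f:\mathbb{R}^n\to\mathbb{R}$ has $K$-bounded derivatives over a box $B$ if $\frac{\partial f(x)}{\partial x_i}\ge K_i^-$ for all $x\in B$, $i\in I^-$, and $\frac{\partial f(x)}{\partial x_i}\le K_i^+$ for all $x\in B$, $i\in I^+$. A real polynomial is a sum of squares (sos) if it is a finite sum of squares of real polynomials. A polynomial $p$ has sos-$K$-bounded derivatives if $K_i^+-\frac{\partial p}{\partial x_i}$ is sos for all $i\in I^+$ and $\frac{\partial p}{\partial x_i}-K_i^-$ is sos for all $i\in I^-$.
   Formalization: The formal theorem assumes n ≥ 2; for n = 1 the double sum in Ξ is empty and the claim fails, e.g. h = x − x³/3 with K⁻ = 0, K⁺ = +∞, where h_ε′ = 1 + ε − x² is not sos. *)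

(* Defs.v *)
From mathcomp Require Import all_boot all_order all_algebra.
From mathcomp Require Import all_classical all_reals all_analysis.
Import Order.TTheory GRing.Theory Num.Theory numFieldNormedType.Exports.
(* The notations of mpoly are incompatible with those of mathcomp-analysis. *)
From mathcomp Require Export -(notations) mpoly.

Set Implicit Arguments.
Unset Strict Implicit.
Unset Printing Implicit Defensive.

Local Open Scope classical_set_scope.
Local Open Scope ring_scope.

Notation "{ 'mpoly' R [ n ] }" := (mpoly n R).

Section Definitions.
Context {R : realType} {n : nat}.
Implicit Types (Km Kp K : 'I_n -> \bar R) (p : {mpoly R[n]}).

Local Notation "''X_' i" := (mpolyX R (mnm1 i) : {mpoly R[n]})
  (at level 8, i at level 2).

Definition poly_fun p : 'rV[R]_n -> R := fun x => meval (x 0) p.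

Definition partial (i : 'I_n) (f : 'rV[R]_n -> R) : 'rV[R]_n -> R :=
  fun x => derive f x (delta_mx 0 i).

Definition continuously_differentiable (f : 'rV[R]_n -> R) : Prop :=
  forall i : 'I_n,
    (forall x, derivable f x (delta_mx 0 i)) /\ continuous (partial i f).

Definition unit_box : set 'rV[R]_n :=
  [set x | forall i : 'I_n, -1 <= x 0 i <= 1].

(* I^- is [finite_indices Km] and I^+ is [finite_indices Kp]. *)
Definition finite_indices K : {set 'I_n} := finset (fun i => K i \is a fin_num).

Definition K_bounded_derivatives Km Kp (B : set 'rV[R]_n)
    (f : 'rV[R]_n -> R) : Prop :=
  [/\ continuously_differentiable f,
      forall x i, B x -> i \in finite_indices Km ->
        (Km i <= (partial i f x)%:E)%E &
      forall x i, B x -> i \in finite_indices Kp ->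
        ((partial i f x)%:E <= Kp i)%E].

Definition sos p : Prop := exists s : seq {mpoly R[n]}, p = \sum_(q <- s) q ^+ 2.

Definition sos_K_bounded_derivatives Km Kp p : Prop :=
  (forall i, i \in finite_indices Kp ->
     sos (mpolyC n (fine (Kp i)) - mderiv i p)) /\
  (forall i, i \in finite_indices Km ->
     sos (mderiv i p - mpolyC n (fine (Km i)))).

(* The order of the tests is irrelevant when I^+ and I^- are disjoint. *)
Definition rho Km Kp (i : 'I_n) : R :=
  if i \in finite_indices Km then 1
  else if i \in finite_indices Kp then -1
  else 0.

(* For n = 1 the double sum is empty and Xi is linear; the sos approximation
   then fails, e.g. for h = x - x^3/3 with K^- = 0 and K^+ = +oo. *)
Definition Xi (r : 'I_n -> R) (d : nat) : {mpoly R[n]} :=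
  \sum_(i < n) r i *: 'X_i +
  \sum_(i < n) \sum_(j < n | (i < j)%N)
    ((4 * r i) *: 'X_i ^+ (2 * d + 1)%N
     + (2 * r j) *: ('X_i ^+ (2 * d)%N * 'X_j)
     + (2 * r i) *: ('X_i * 'X_j ^+ (2 * d)%N)
     + (4 * r j) *: 'X_j ^+ (2 * d + 1)%N).

End Definitions.

(* Main.v *)
Require Import Defs.
From mathcomp Require Import all_boot all_order all_algebra.
From mathcomp Require Import all_classical all_reals all_analysis.
From mathcomp Require Import ring lra.
Import Order.TTheory GRing.Theory Num.Theory numFieldNormedType.Exports.

Local Open Scope ring_scope.

(** Write [rho_k = 1] or [-1] according to whether the [k]-th derivative is
    bounded below or above, and let [g = rho_k (d_k h - K_k)], a polynomial which
    is nonnegative on the unit box. The claim is that [g + eps rho_k d_k Xi] is a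
    sum of squares for all large [d]. It follows from two facts, where
    [T_d = 1 + sum_j x_j^(2 d)].

    The first is that [rho_k d_k Xi - T_d] is a sum of squares for [d >= 1]
    ([sos_mderiv_Xi]). For each [j <> k], the mixed monomial
    [x_k^(2 d - 1) x_j] in the [k]-th derivative is dominated by the two pure
    powers, by completing a square and then using the arithmetic-geometric mean
    inequality, whose difference of sides is an explicit sum of squares
    ([sos_amgm]).

    The second is that [g + eps T_d] is a sum of squares for large [d] whenever
    [g] is nonnegative on the unit box. The intermediate notion is approximation
    by sums of squares in the l1 norm of the coefficients. A monomial with
    coefficient [c] is at most [|c| T_d] up to a sum of squares once [d] is large,
    so an l1-small error is absorbed by [eps T_d] ([sos_approx_perturb]). The
    polynomials that can be so approximated form a closed cone, stable under
    products because the norm is submultiplicative. This cone contains [1 - x_i^2]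
    ([sos_approx_1_sub_sqrX]), hence
    [1 + x_i = ((1 + x_i)^2 + (1 - x_i^2)) / 2] and likewise [1 - x_i], hence all
    their products, and so all products of Bernstein polynomials in the variables
    [(1 + x_i) / 2]. Expanded over products of Bernstein polynomials of high
    degree, [g] has coefficients arbitrarily close to its values at points of the
    box, so [g + e] has nonnegative coefficients for each [e > 0], which puts [g]
    in the closed cone ([sos_approx_nonneg]). *)

(** * The cone of sums of squares *)
Section SosCone.
Context {R : realType} {n : nat}.
Implicit Types (p q a b : {mpoly R[n]}) (c : R).

Lemma sos_sqr p : sos (p ^+ 2).
Proof. by exists [:: p]; rewrite big_seq1. Qed.

Lemma sos0 : sos (0 : {mpoly R[n]}).
Proof. by exists [::]; rewrite big_nil. Qed.

Lemma sos1 : sos (1 : {mpoly R[n]}).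
Proof. by rewrite -(expr1n _ 2); apply: sos_sqr. Qed.

Lemma sosD p q : sos p -> sos q -> sos (p + q).
Proof. by move=> [s ->] [t ->]; exists (s ++ t); rewrite big_cat. Qed.

Lemma sos_sum I (r : seq I) (P : pred I) (F : I -> {mpoly R[n]}) :
  (forall i, P i -> sos (F i)) -> sos (\sum_(i <- r | P i) F i).
Proof. by move=> h; elim/big_ind: _ => //; [exact: sos0|exact: sosD]. Qed.

Lemma sosM p q : sos p -> sos q -> sos (p * q).
Proof.
move=> [s ->] [t ->]; rewrite mulr_suml; apply: sos_sum => u _.
rewrite mulr_sumr; apply: sos_sum => v _.
by rewrite -exprMn; apply: sos_sqr.
Qed.

Lemma sosX p k : sos p -> sos (p ^+ k).
Proof.
move=> hp; elim: k => [|k IH]; first by rewrite expr0; exact: sos1.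
by rewrite exprS; apply: sosM.
Qed.

Lemma sosZ c p : 0 <= c -> sos p -> sos (c *: p).
Proof.
move=> c0 [s ->]; rewrite scaler_sumr; apply: sos_sum => q _.
by rewrite -(sqr_sqrtr c0) -exprZn; apply: sos_sqr.
Qed.

Lemma sosMn p k : sos p -> sos (p *+ k).
Proof. by move=> hp; rewrite -scaler_nat; apply: sosZ. Qed.

Lemma sos_nat k : sos (k%:R : {mpoly R[n]}).
Proof. exact/sosMn/sos1. Qed.

(** The weighted arithmetic-geometric mean inequality
    [(d+1) a^d b <= d a^(d+1) + b^(d+1)] with a sum of squares certificate: if
    [G_d] is the difference of the two sides, then
    [G_(d+1) = b G_d + (d+1) a^d (a - b)^2]. *)
Lemma sos_amgm a b d : sos a -> sos b ->
  sos (d%:R * a ^+ d.+1 - d.+1%:R * a ^+ d * b + b ^+ d.+1).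
Proof.
move=> sa sb; elim: d => [|d IH].
  by rewrite (_ : _ + _ = 0); [exact: sos0 | rewrite !expr1 expr0; ring].
have -> : d.+1%:R * a ^+ d.+2 - d.+2%:R * a ^+ d.+1 * b + b ^+ d.+2 =
    b * (d%:R * a ^+ d.+1 - d.+1%:R * a ^+ d * b + b ^+ d.+1) +
    (d.+1%:R * a ^+ d) * (a - b) ^+ 2.
  by rewrite !exprS -!natr1; ring.
apply: sosD; first exact: sosM.
by apply: sosM (sos_sqr _); apply: sosM (sos_nat _) (sosX _ _ _).
Qed.

Lemma sos_1_sub_mul a k l : sos a -> sos ((1 - a ^+ k) * (1 - a ^+ l)).
Proof.
move=> sa.
have E m : 1 - a ^+ m = - (a - 1) * (\sum_(i < m) a ^+ i).
  by rewrite mulNr -subrX1 opprB.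
rewrite !E mulrACA mulrNN -expr2; apply: sosM; first exact: sos_sqr.
by apply: sosM; apply: sos_sum => i _; apply: sosX.
Qed.

End SosCone.

(** * Approximation by sums of squares in the l1 norm of the coefficients *)
Section L1Approx.
Context {R : realType} {n : nat}.
Implicit Types (p q s : {mpoly R[n]}) (c e : R) (u : R * multinom n).

Local Notation "''X_' i" := (mpolyX R (mnm1 i) : {mpoly R[n]})
  (at level 8, i at level 2).

(** The bound is on the coefficients of some, possibly redundant, way of writing
    [q] as a combination of monomials: concatenating and multiplying out two
    lists then gives the triangle inequality and submultiplicativity. *)
Definition l1_le q c : Prop := exists2 r : seq (R * multinom n),
  q = \sum_(u <- r) u.1 *: mpolyX R u.2 & \sum_(u <- r) `|u.1| <= c.

Lemma l1_le_ex q : exists2 c, 0 < c & l1_le q c.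
Proof.
exists (1 + \sum_(m <- msupp q) `|mcoeff m q|).
  by rewrite ltr_pwDl // sumr_ge0.
exists [seq (mcoeff m q, m) | m <- msupp q]; rewrite big_map ?lerDr //=.
exact: mpolyE.
Qed.

Lemma l1_leD q q' c c' : l1_le q c -> l1_le q' c' -> l1_le (q + q') (c + c').
Proof.
move=> [r -> hr] [r' -> hr']; exists (r ++ r'); rewrite big_cat //=.
exact: lerD.
Qed.

Lemma l1_leW q c c' : c <= c' -> l1_le q c -> l1_le q c'.
Proof. by move=> cc' [r -> hr]; exists r => //; apply: le_trans cc'. Qed.

Lemma l1_leM q q' c c' : l1_le q c -> l1_le q' c' -> l1_le (q * q') (c * c').
Proof.
move=> [r -> hr] [r' -> hr'].
exists [seq (u.1 * v.1, mnm_add u.2 v.2) | u <- r, v <- r'].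
  rewrite big_allpairs_dep mulr_suml; apply: eq_bigr => u _.
  rewrite mulr_sumr; apply: eq_bigr => v _.
  by rewrite -scalerAl -scalerAr scalerA mpolyXD.
rewrite big_allpairs_dep /=.
apply: (@le_trans _ _ ((\sum_(u <- r) `|u.1|) * (\sum_(v <- r') `|v.1|))).
  rewrite mulr_suml ler_sum // => u _; rewrite mulr_sumr ler_sum // => v _.
  by rewrite normrM.
by apply: ler_pM => //; apply: sumr_ge0.
Qed.

Lemma l1_leZX c m : l1_le (c *: mpolyX R m) `|c|.
Proof. by exists [:: (c, m)]; rewrite big_seq1. Qed.

Lemma l1_leC c : l1_le (mpolyC n c) `|c|.
Proof.
by have := l1_leZX c mnm0; rewrite mpolyX0 -mul_mpolyC mulr1.
Qed.

Lemma l1_le0 : l1_le 0 0.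
Proof. by exists [::]; rewrite big_nil. Qed.

Definition sos_approx p : Prop :=
  forall e, 0 < e -> exists2 s, sos s & l1_le (p - s) e.

Lemma sos_sos_approx p : sos p -> sos_approx p.
Proof.
move=> sp e e0; exists p => //; rewrite subrr.
exact: l1_leW (ltW e0) l1_le0.
Qed.

Lemma sos_approxD p q : sos_approx p -> sos_approx q -> sos_approx (p + q).
Proof.
move=> ap aq e e0; have e20 : 0 < e / 2 by lra.
have [s ss hs] := ap _ e20; have [t st ht] := aq _ e20.
exists (s + t); first exact: sosD.
by rewrite opprD addrACA [e]splitr; apply: l1_leD.
Qed.

Lemma sos_approx_sum I (r : seq I) (P : pred I) (F : I -> {mpoly R[n]}) :
  (forall i, P i -> sos_approx (F i)) -> sos_approx (\sum_(i <- r | P i) F i).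
Proof.
move=> h; elim/big_ind: _ => //; last exact: sos_approxD.
exact/sos_sos_approx/sos0.
Qed.

Lemma sos_approxM p q : sos_approx p -> sos_approx q -> sos_approx (p * q).
Proof.
move=> ap aq e e0.
have [c c0 pc] := l1_le_ex p.
have [|t st ht] := aq (e / 2 / c); first by rewrite !divr_gt0.
(* The factor [t] is fixed first, so that the accuracy required of the
   approximation of [p] can depend on the norm of [t]. *)
have [d d0 td] := l1_le_ex t.
have [|s ss hs] := ap (e / 2 / d); first by rewrite !divr_gt0.
exists (s * t); first exact: sosM.
have -> : p * q - s * t = p * (q - t) + (p - s) * t by ring.
have -> : e = c * (e / 2 / c) + (e / 2 / d) * d.
  by field; rewrite !gt_eqF.
by apply: l1_leD; apply: l1_leM.
Qed.

Lemma sos_approxX p k : sos_approx p -> sos_approx (p ^+ k).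
Proof.
move=> ap; elim: k => [|k IH]; first by rewrite expr0; exact/sos_sos_approx/sos1.
by rewrite exprS; apply: sos_approxM.
Qed.

Lemma sos_approx_prod I (r : seq I) (P : pred I) (F : I -> {mpoly R[n]}) :
  (forall i, P i -> sos_approx (F i)) -> sos_approx (\prod_(i <- r | P i) F i).
Proof.
move=> h; elim/big_ind: _ => //; last exact: sos_approxM.
exact/sos_sos_approx/sos1.
Qed.

Lemma sos_approxZ c p : 0 <= c -> sos_approx p -> sos_approx (c *: p).
Proof.
move=> c0 ap; rewrite -mul_mpolyC; apply: sos_approxM => //.
apply: sos_sos_approx; rewrite -[mpolyC n c]mulr1 mul_mpolyC.
by apply: sosZ; last exact: sos1.
Qed.

Lemma sos_approx_closed p :
  (forall e, 0 < e -> sos_approx (p + mpolyC n e)) -> sos_approx p.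
Proof.
move=> h e e0; have e20 : 0 < e / 2 by lra.
have [s ss hs] := h _ e20 _ e20; exists s => //.
have -> : p - s = (p + mpolyC n (e / 2) - s) + mpolyC n (- (e / 2)).
  by rewrite mpolyCN; ring.
rewrite [X in l1_le _ X]splitr; apply: l1_leD => //.
by apply: l1_leW (l1_leC _); rewrite normrN gtr0_norm.
Qed.

(** By the arithmetic-geometric mean inequality,
    [d (1 - x^2) = (d - 1 - d x^2 + x^(2 d)) + (1 - x^(2 d))] is a sum of squares
    up to an error whose norm does not grow with [d]. *)
Lemma sos_approx_1_sub_sqrX i : sos_approx (1 - 'X_i ^+ 2).
Proof.
move=> e e0.
pose d := (Num.bound (2 / e)).+1.
have d0 : 0 < d%:R :> R by rewrite ltr0n.
have de : 2 / d%:R <= e.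
  rewrite ler_pdivrMr // -ler_pdivrMl // mulrC ltW //.
  rewrite (lt_trans (archi_boundP _)) ?divr_ge0 ?ltW //.
  by rewrite ltr_nat.
exists (d%:R^-1 *: (d.-1%:R * 1 ^+ d - d%:R * 1 ^+ d.-1 * 'X_i ^+ 2 +
                    ('X_i ^+ 2) ^+ d)).
  apply: sosZ; first by rewrite invr_ge0 ltW.
  by apply: sos_amgm; [exact: sos1 | exact: sos_sqr].
have -> : 1 - 'X_i ^+ 2 = d%:R^-1 *: (d%:R * (1 - 'X_i ^+ 2)).
  by rewrite mulr_natl -(scaler_nat d (1 - _)) scalerA mulVf ?scale1r ?gt_eqF.
rewrite -scalerBr !expr1n !mulr1.
have -> : d%:R * (1 - 'X_i ^+ 2) - (d.-1%:R - d%:R * 'X_i ^+ 2 + ('X_i ^+ 2) ^+ d)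
   = 1 - ('X_i ^+ 2) ^+ d.
  by rewrite /d /= -natr1; ring.
apply: l1_leW de _; rewrite scalerBr -exprM.
have -> : 2 / d%:R = `|d%:R^-1| + `|- d%:R^-1| :> R.
  by rewrite normrN gtr0_norm ?invr_gt0 //; ring.
apply: l1_leD; first by have := l1_leZX d%:R^-1 mnm0; rewrite mpolyX0.
by rewrite -scaleNr mpolyXn; apply: l1_leZX.
Qed.

(** [1 + c x = ((1 + c x)^2 + (1 - x^2)) / 2] when [c] is [1] or [-1]; the factor
    [1/2] turns it into the barycentric coordinate of [x] in the segment from
    [-1] to [1]. *)
Lemma sos_approx_half_1X (c : R) i :
  c ^+ 2 = 1 -> sos_approx (2^-1 *: (1 + c *: 'X_i)).
Proof.
move=> c2.
have -> : 2^-1 *: (1 + c *: 'X_i) =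
    2^-1 *: (2^-1 *: (1 + c *: 'X_i) ^+ 2) + 2^-1 *: (2^-1 *: (1 - 'X_i ^+ 2)).
  rewrite -!scalerDr; congr (_ *: _).
  have -> : (1 + c *: 'X_i) ^+ 2 + (1 - 'X_i ^+ 2) = (1 + c *: 'X_i) *+ 2.
    rewrite sqrrD exprZn c2 scale1r expr1n mul1r mulrnDl; ring.
  by rewrite -(scaler_nat 2 (1 + _)) scalerA mulVf ?scale1r // pnatr_eq0.
apply: sos_approxD; do 2 (apply: sos_approxZ; first by rewrite invr_ge0).
  exact/sos_sos_approx/sos_sqr.
exact: sos_approx_1_sub_sqrX.
Qed.

End L1Approx.

(** * Polynomials nonnegative on the unit box *)
Section Bernstein.
Context {R : realType}.

Definition ffact_ratio (N m k : nat) : R := (k ^_ m)%:R / (N ^_ m)%:R.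

Lemma ffact_ratioS N m k :
  ffact_ratio N m.+1 k = ffact_ratio N m k * ((k - m)%:R / (N - m)%:R).
Proof. by rewrite /ffact_ratio !ffactnSr !natrM invfM; ring. Qed.

Lemma ffact_ratio01 N m k : (k <= N)%N -> 0 <= ffact_ratio N m k <= 1.
Proof.
move=> kN; elim: m => [|m /andP[IH0 IH1]].
  by rewrite /ffact_ratio !ffactn0 divr1 ler01 lexx.
have q0 : 0 <= (k - m)%:R / (N - m)%:R :> R by rewrite divr_ge0.
have q1 : (k - m)%:R / (N - m)%:R <= 1 :> R.
  case: (posnP (N - m)) => [->|Nm]; first by rewrite invr0 mulr0 ler01.
  by rewrite ler_pdivrMr ?ltr0n // mul1r ler_nat leq_sub2r.
by rewrite ffact_ratioS mulr_ge0 //= mulr_ile1.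
Qed.

(** Drawing [m] balls out of [N], of which [k] are marked, without and with
    replacement gives nearly the same probability of only seeing marked ones. *)
Lemma ffact_ratio_dist N m k : (k <= N)%N -> (m <= N)%N ->
  `|ffact_ratio N m k - (k%:R / N%:R) ^+ m| <= (m * m)%:R / N%:R.
Proof.
move=> kN; elim: m => [|m IH] mN.
  by rewrite /ffact_ratio !ffactn0 divr1 expr0 subrr normr0 mul0n mul0r.
have {}IH := IH (ltnW mN).
have N0 : 0 < N%:R :> R by rewrite ltr0n (leq_trans _ mN).
have y0 : 0 <= k%:R / N%:R :> R by rewrite divr_ge0.
have y1 : k%:R / N%:R <= 1 :> R by rewrite ler_pdivrMr // mul1r ler_nat.
have := ffact_ratio01 N m k kN; move: IH; rewrite ffact_ratioS exprSr.
set u := ffact_ratio N m k; set v := (_ / _) ^+ m.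
set a := (k - m)%:R / _; set b := k%:R / N%:R => uv /andP[u0 u1].
apply: (@le_trans _ _ (`|u - v| + m%:R / N%:R)); last first.
  apply: (le_trans (lerD uv (lexx _))).
  rewrite -mulrDl ler_pM2r ?invr_gt0 // -natrD ler_nat.
  by rewrite -mulnSr leq_mul2r leqnSn orbT.
have -> : u * a - v * b = (u - v) * b + u * (a - b) by ring.
rewrite (le_trans (ler_normD _ _)) // lerD //.
  by rewrite normrM (ger0_norm y0) ler_piMr.
case: (ltnP k m) => km.
  by rewrite /u /ffact_ratio ffact_small // !mul0r normr0 divr_ge0.
rewrite normrM (ger0_norm u0) (le_trans (ler_piMl _ u1)) //.
have Nm0 : 0 < N%:R - m%:R :> R by rewrite subr_gt0 ltr_nat.
rewrite /a /b !natrB // ?(ltnW mN) //.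
have -> : (k%:R - m%:R) / (N%:R - m%:R) - k%:R / N%:R =
   - (m%:R / N%:R * ((N%:R - k%:R) / (N%:R - m%:R))) :> R.
  by field; rewrite !gt_eqF.
have c0 : 0 <= (N%:R - k%:R) / (N%:R - m%:R) :> R.
  by rewrite divr_ge0 ?subr_ge0 ?ler_nat // ltnW.
rewrite normrN ger0_norm; last by rewrite mulr_ge0 // divr_ge0.
rewrite ler_piMr ?divr_ge0 //.
by rewrite ler_pdivrMr // mul1r lerD2l lerN2 ler_nat.
Qed.

Lemma prod_dist_le I (r : seq I) (F G : I -> R) :
  (forall i, 0 <= F i <= 1) -> (forall i, 0 <= G i <= 1) ->
  `|\prod_(i <- r) F i - \prod_(i <- r) G i| <= \sum_(i <- r) `|F i - G i|.
Proof.
move=> hF hG; elim: r => [|i r IH]; first by rewrite !big_nil subrr normr0.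
have P01 (H : I -> R) : (forall i, 0 <= H i <= 1) ->
    0 <= \prod_(i <- r) H i <= 1.
  move=> hH; rewrite prodr_ge0 /=; last by move=> j _; case/andP: (hH j).
  by rewrite prodr_ile1.
have /andP[G0 G1] := P01 _ hG; have /andP[Fi0 Fi1] := hF i.
rewrite !big_cons; move: IH G0 G1; set p := \prod_(j <- r) F j.
set q := \prod_(j <- r) G j => IH q0 q1.
have -> : F i * p - G i * q = (F i - G i) * q + F i * (p - q) by ring.
rewrite (le_trans (ler_normD _ _)) // !normrM (ger0_norm q0) (ger0_norm Fi0).
by apply: lerD; [rewrite ler_piMr | rewrite (le_trans (ler_piMl _ Fi1))].
Qed.

Context {n : nat}.
Implicit Types (p q t : {mpoly R[n]}).

Definition bernstein N k t : {mpoly R[n]} :=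
  (t ^+ k * (1 - t) ^+ (N - k)) *+ 'C(N, k).

Lemma sum_bernstein N t : \sum_(k < N.+1) bernstein N k t = 1.
Proof.
rewrite -(expr1n _ N) -(subrK t 1) exprDn.
by apply: eq_bigr => k _; rewrite /bernstein mulrC.
Qed.

Lemma ffact_bin m l j : (j <= l)%N ->
  ((m + j) ^_ m * 'C(m + l, m + j) = (m + l) ^_ m * 'C(l, j))%N.
Proof.
move=> jl; apply/eqP; rewrite -(@eqn_pmul2r (j`! * (l - j)`!)); last first.
  by rewrite muln_gt0 !fact_gt0.
have := ffact_fact (leq_addr j m); rewrite addKn => h1.
have := ffact_fact (leq_addr l m); rewrite addKn => h2.
have h3 : ('C(m + l, m + j) * ((m + j)`! * (l - j)`!) = (m + l)`!)%N.
  by rewrite -(@bin_fact (m + l) (m + j)) ?leq_add2l // subnDl.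
have h4 := bin_fact jl.
by rewrite -[X in _ == X]mulnA h4 h2 -h3 -h1; apply/eqP; ring.
Qed.

(** Expanding [(t + (1 - t))^(N - m)] in [t^m (t + (1 - t))^(N - m)] gives an exact
    combination of Bernstein polynomials of degree [N], with coefficients close
    to the values [(k / N)^m] of the power at the nodes. *)
Lemma exp_bernstein N m t : (m <= N)%N ->
  t ^+ m = \sum_(k < N.+1) ffact_ratio N m k *: bernstein N k t.
Proof.
move=> /subnKC <-; move: (N - m)%N => l {N}.
rewrite -(big_mkord xpredT (fun k => ffact_ratio _ m k *: bernstein _ k t)).
(* The terms with [k < m] vanish with the falling factorial. *)
rewrite (@big_cat_nat _ _ _ m) //=; last by rewrite leqW // leq_addr.
rewrite big_nat_cond big1 ?add0r => [|k]; last first.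
  rewrite andbT => /andP[_ km].
  by rewrite /ffact_ratio ffact_small // mul0r scale0r.
rewrite -{2}(add0n m) big_addn -addnS addKn big_mkord.
rewrite -{1}[t ^+ m]mulr1 -(sum_bernstein l t) mulr_sumr.
apply: eq_bigr => j _; rewrite /bernstein [(j + m)%N]addnC subnDl exprD.
rewrite mulrnAr mulrA; set z := _ * _ * _.
rewrite -(scaler_nat 'C(l, j)) -(scaler_nat 'C(m + l, m + j)) scalerA.
congr (_ *: _); have j_l : (j <= l)%N by rewrite -ltnS.
(* The ratio of falling factorials turns C(m + l, m + j) into C(l, j). *)
rewrite /ffact_ratio mulrAC -natrM ffact_bin // natrM mulrAC mulfV ?mul1r //.
by rewrite pnatr_eq0 -lt0n ffact_gt0 leq_addr.
Qed.

End Bernstein.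

Section NonnegBox.
Context {R : realType} {n : nat}.
Implicit Types (g t : {mpoly R[n]}).

Local Notation "''X_' i" := (mpolyX R (mnm1 i) : {mpoly R[n]})
  (at level 8, i at level 2).

Lemma comp_bernstein k (G : {mpoly R[k]}) (t : k.-tuple {mpoly R[n]}) N e :
  (msize G <= N)%N ->
  comp_mpoly t G + mpolyC n e =
  \sum_(f : {ffun 'I_k -> 'I_N.+1})
    (\sum_(m <- msupp G) mcoeff m G * \prod_i ffact_ratio N (m i) (f i) + e) *:
    \prod_i bernstein N (f i) (tnth t i).
Proof.
move=> GN; under eq_bigr do rewrite scalerDl; rewrite big_split /=; congr (_ + _).
  rewrite comp_mpolyE; under [RHS]eq_bigr do rewrite scaler_suml.
  rewrite exchange_big /=; rewrite big_seq [RHS]big_seq.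
  apply: eq_bigr => m mG.
  under [RHS]eq_bigr do rewrite -scalerA -scaler_prod.
  rewrite -scaler_sumr; congr (_ *: _).
  rewrite -(bigA_distr_bigA
    (fun i (j : 'I_N.+1) => ffact_ratio N (m i) j *: bernstein N j (tnth t i))).
  apply: eq_bigr => i _; apply: exp_bernstein.
  rewrite (leq_trans _ GN) // (leq_trans _ (msize_mdeg_lt mG)) // leqW //.
  by rewrite mdegE (bigD1 i) //= leq_addr.
rewrite -scaler_sumr.
rewrite -(bigA_distr_bigA (fun i (j : 'I_N.+1) => bernstein N j (tnth t i))).
under eq_bigr do rewrite sum_bernstein.
by rewrite big1_eq -mul_mpolyC mulr1.
Qed.

(** Every coefficient of the Bernstein expansion of [G] is, up to [O(1/N)], a
    value of [G] on the grid of step [1/N] in the unit cube. An arbitrarily small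
    constant added to [G] therefore makes all of them nonnegative. *)
Lemma sos_approx_comp k (G : {mpoly R[k]}) (t : k.-tuple {mpoly R[n]}) :
  (forall y : 'I_k -> R, (forall i, 0 <= y i <= 1) -> 0 <= meval y G) ->
  (forall i, sos_approx (tnth t i)) ->
  (forall i, sos_approx (1 - tnth t i)) ->
  sos_approx (comp_mpoly t G).
Proof.
move=> G0 t0 t1; apply: sos_approx_closed => e e0.
pose L : R := \sum_(m <- msupp G) `|mcoeff m G| * \sum_i (m i * m i)%:R.
have L0 : 0 <= L by apply: sumr_ge0 => m _; rewrite mulr_ge0 // sumr_ge0.
pose N := (maxn (Num.bound (L / e)) (msize G)).+1.
have GN : (msize G <= N)%N by rewrite leqW // leq_maxr.
have N0 : 0 < N%:R :> R by rewrite ltr0n.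
have LN : L / N%:R <= e.
  rewrite ler_pdivrMr // mulrC -ler_pdivrMr // ltW //.
  rewrite (lt_le_trans (archi_boundP _)) ?(divr_ge0 L0 (ltW e0)) //.
  by rewrite ler_nat leqW // leq_maxl.
rewrite (comp_bernstein k G t N e GN); apply: sos_approx_sum => f _.
apply: sos_approxZ; last first.
  apply: sos_approx_prod => i _; rewrite /bernstein -scaler_nat.
  by apply: sos_approxZ => //; apply: sos_approxM; apply: sos_approxX.
pose y i : R := (f i)%:R / N%:R.
have fN i : (f i <= N)%N by rewrite -ltnS.
have y01 i : 0 <= y i <= 1.
  by rewrite divr_ge0 //= ler_pdivrMr // mul1r ler_nat.
apply: (le_trans (G0 _ y01)); rewrite mevalE -lerBlDl -sumrB.
apply: le_trans LN; apply: (le_trans (ler_norm _)).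
apply: (le_trans (ler_norm_sum _ _ _)); rewrite /L mulr_suml.
rewrite big_seq [leRHS]big_seq; apply: ler_sum => m mG.
rewrite -mulrBr normrM -mulrA ler_wpM2l // distrC mulr_suml.
have y01m i : 0 <= y i ^+ m i <= 1.
  by have /andP[? ?] := y01 i; rewrite exprn_ge0 //= exprn_ile1.
apply: (le_trans (prod_dist_le _ _ _ _ (fun i => ffact_ratio01 N (m i) _ (fN i))
  y01m)).
apply: ler_sum => i _; apply: ffact_ratio_dist => //.
rewrite (leq_trans _ GN) // (leq_trans _ (msize_mdeg_lt mG)) // leqW //.
by rewrite mdegE (bigD1 i) //= leq_addr.
Qed.

(** The change of variables [x = 2 y - 1] maps the unit cube to the unit box;
    both [y = (1 + x) / 2] and [1 - y = (1 - x) / 2] are approximable. *)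
Lemma sos_approx_nonneg g :
  (forall x : 'I_n -> R, (forall i, -1 <= x i <= 1) -> 0 <= meval x g) ->
  sos_approx g.
Proof.
move=> g0.
pose T := [tuple (2%:R *: 'X_i - 1) | i < n].
pose t := [tuple (2^-1 *: (1 + (1 : R) *: 'X_i)) | i < n].
have tE i : tnth t i = 2^-1 *: (1 + 'X_i) by rewrite tnth_mktuple scale1r.
have -> : g = comp_mpoly t (comp_mpoly T g).
  rewrite [comp_mpoly T g]comp_mpolyE raddf_sum {1}(mpolyE g) /=.
  apply: eq_bigr => m _; rewrite comp_mpolyZ; congr (_ *: _).
  rewrite mpolyXE_id rmorph_prod; apply: eq_bigr => i _ /=.
  rewrite rmorphXn /=; congr (_ ^+ _); rewrite tnth_mktuple.
  rewrite comp_mpolyB comp_mpolyZ comp_mpoly1 comp_mpolyXU -tnth_nth tE.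
  by rewrite scalerA mulfV ?pnatr_eq0 // scale1r addrC addKr.
apply: sos_approx_comp => [y y01|i|i].
- rewrite comp_mpoly_meval; apply: g0 => i; rewrite tnth_mktuple.
  rewrite mevalB mevalZ meval1 mevalXU; have := y01 i.
  by move=> /andP[? ?]; apply/andP; split; lra.
- by rewrite tnth_mktuple; apply: sos_approx_half_1X; rewrite expr1n.
- have -> : 1 - tnth t i = 2^-1 *: (1 + (-1 : R) *: 'X_i).
    rewrite tE scaleN1r; apply: (scalerI (_ : 2%:R != 0 :> R)) => //.
    rewrite scalerBr !scalerA mulfV ?pnatr_eq0 // !scale1r scaler_nat.
    by ring.
  by apply: sos_approx_half_1X; rewrite sqrrN expr1n.
Qed.

End NonnegBox.

(** * Perturbation by high even powers *)
Section Perturbation.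
Context {R : realType} {n : nat}.
Implicit Types (g q s : {mpoly R[n]}) (c e : R).

Local Notation "''X_' i" := (mpolyX R (mnm1 i) : {mpoly R[n]})
  (at level 8, i at level 2).

Definition even_power_sum d : {mpoly R[n]} := 1 + \sum_i ('X_i ^+ 2) ^+ d.

Lemma sos_even_power_sum d : sos (even_power_sum d).
Proof.
apply: sosD; first exact: sos1.
by apply: sos_sum => i _; apply/sosX/sos_sqr.
Qed.

(** Bounding squares makes products tractable, since [2 q^2 q'^2 <= q^4 + q'^4]
    only involves the squares of [q^2] and of [q'^2]. A bound on [q] of either sign
    is recovered from [2 |q| <= 1 + q^2]. *)
Definition sqr_bounded q : Prop :=
  exists D : nat, forall d, (D <= d)%N -> sos (even_power_sum d - q ^+ 2).

Lemma sqr_bounded1 : sqr_bounded 1.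
Proof.
exists 0%N => d _; rewrite /even_power_sum expr1n addrC addKr.
by apply: sos_sum => i _; apply/sosX/sos_sqr.
Qed.

(** With [a = x_i^2], [1 + a^d - a^k = a^(d - k) + (1 - a^k) (1 - a^(d - k))]. *)
Lemma sqr_boundedXn i k : sqr_bounded ('X_i ^+ k).
Proof.
exists k => d kd; set a := 'X_i ^+ 2.
have sa : sos a by exact: sos_sqr.
rewrite /even_power_sum (bigD1 i) //= -(exprM _ k 2) mulnC exprM -/a.
have -> : 1 + (a ^+ d + \sum_(j < n | j != i) ('X_j ^+ 2) ^+ d) - a ^+ k =
    a ^+ (d - k) + (1 - a ^+ k) * (1 - a ^+ (d - k)) +
    \sum_(j < n | j != i) ('X_j ^+ 2) ^+ d.
  by rewrite -{1}(subnKC kd) exprD; ring.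
apply: sosD; first by apply: sosD; [exact: sosX | exact: sos_1_sub_mul].
by apply: sos_sum => j _; apply/sosX/sos_sqr.
Qed.

Lemma sqr_boundedM q q' :
  sqr_bounded (q ^+ 2) -> sqr_bounded (q' ^+ 2) -> sqr_bounded (q * q').
Proof.
move=> [D hD] [D' hD']; exists (maxn D D') => d; rewrite geq_max => /andP[Dd D'd].
have -> : even_power_sum d - (q * q') ^+ 2 =
    2^-1 *: ((even_power_sum d - (q ^+ 2) ^+ 2) +
             (even_power_sum d - (q' ^+ 2) ^+ 2) + (q ^+ 2 - q' ^+ 2) ^+ 2).
  apply: (scalerI (_ : 2%:R != 0 :> R)) => //.
  by rewrite scalerA mulfV ?pnatr_eq0 // scale1r scaler_nat; ring.
apply: sosZ; first by rewrite invr_ge0.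
by apply: sosD (sos_sqr _); apply: sosD; auto.
Qed.

Lemma sqr_boundedX m : sqr_bounded (mpolyX R m).
Proof.
rewrite mpolyXE_id; move: (index_enum _) => r; move: (fun_of_multinom m) => k.
elim: r k => [|i r IH] k; first by rewrite big_nil; exact: sqr_bounded1.
rewrite big_cons; apply: sqr_boundedM.
  by rewrite -exprM; exact: sqr_boundedXn.
rewrite -prodrXl; under eq_bigr do rewrite -exprM.
exact: (IH (fun j => (k j * 2)%N)).
Qed.

Lemma sos_even_power_sumDZ c q d : sos (even_power_sum d - q ^+ 2) ->
  sos (`|c| *: even_power_sum d + c *: q).
Proof.
move=> hq.
have hb (b : R) : b ^+ 2 = 1 -> sos (even_power_sum d + b *: q).
  move=> b2; have -> : even_power_sum d + b *: q =
      2^-1 *: ((1 + b *: q) ^+ 2 + (even_power_sum d - q ^+ 2) +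
               \sum_i ('X_i ^+ 2) ^+ d).
    apply: (scalerI (_ : 2%:R != 0 :> R)) => //.
    rewrite scalerA mulfV ?pnatr_eq0 // scale1r scaler_nat.
    by rewrite sqrrD exprZn b2 scale1r /even_power_sum; ring.
  apply: sosZ; first by rewrite invr_ge0.
  apply: sosD; first by apply: sosD => //; exact: sos_sqr.
  by apply: sos_sum => i _; apply/sosX/sos_sqr.
case: (leP 0 c) => c0.
  rewrite ger0_norm // -scalerDr -[q in _ + q]scale1r.
  by apply: sosZ => //; apply: hb; rewrite expr1n.
rewrite ltr0_norm //.
have -> : c *: q = - c *: (-1 *: q) by rewrite scalerA mulrN1 opprK.
rewrite -scalerDr; apply: sosZ; first by rewrite oppr_ge0 ltW.
by apply: hb; rewrite sqrrN expr1n.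
Qed.

(** Each of the finitely many monomials of the l1-small error is dominated by
    the even power sum, with its coefficient as the constant. *)
Lemma sos_approx_perturb g e : sos_approx g -> 0 < e ->
  exists D : nat, forall d, (D <= d)%N -> sos (g + e *: even_power_sum d).
Proof.
move=> ag e0; have [s ss [r gs re]] := ag _ e0.
have [D hD] : exists D : nat, forall d, (D <= d)%N ->
    sos ((\sum_(u <- r) `|u.1|) *: even_power_sum d +
         \sum_(u <- r) u.1 *: mpolyX R u.2).
  elim: r {gs re} => [|u r [D hD]].
    by exists 0%N => d _; rewrite !big_nil scale0r addr0; exact: sos0.
  have [D' hD'] := sqr_boundedX u.2.
  exists (maxn D D') => d; rewrite geq_max => /andP[Dd D'd].
  rewrite !big_cons scalerDl addrACA; apply: sosD; last exact: hD.
  by apply: sos_even_power_sumDZ; exact: hD'.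
exists D => d Dd.
have -> : g + e *: even_power_sum d = s +
    ((\sum_(u <- r) `|u.1|) *: even_power_sum d + \sum_(u <- r) u.1 *: mpolyX R u.2)
    + (e - \sum_(u <- r) `|u.1|) *: even_power_sum d.
  by rewrite -gs scalerBl; ring.
apply: sosD; first by apply: sosD => //; exact: hD.
by apply: sosZ; [rewrite subr_ge0 | exact: sos_even_power_sum].
Qed.

End Perturbation.

(** * Partial derivatives of polynomial functions *)
Section Derivatives.
Context {R : realType} {n : nat}.
Implicit Types (p : {mpoly R[n]}) (x : 'rV[R]_n).

Local Notation "''X_' i" := (mpolyX R (mnm1 i) : {mpoly R[n]})
  (at level 8, i at level 2).

Lemma mderivXU (i k : 'I_n) : mderiv k 'X_i = (i == k)%:R.
Proof.
rewrite mderivX mnm1E; case: eqVneq => [->|_]; last by rewrite scale0r.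
by rewrite scale1r (_ : mnm_sub _ _ = mnm0) ?mpolyX0 //; apply/mnmP => j;
  rewrite mnmBE subnn mnm0E.
Qed.

Lemma mderivXn (k : 'I_n) p m : mderiv k (p ^+ m) = mderiv k p * p ^+ m.-1 *+ m.
Proof.
elim: m => [|m IH]; first by rewrite expr0 mulr0n -mpolyC1 mderivC.
rewrite exprS mderivM IH /= mulrS; congr (_ + _).
by case: m {IH} => [|m] /=; rewrite ?mulr0n ?mulr0 // mulrnAr exprS; congr (_ *+ _); ring.
Qed.

Lemma is_derive_poly_fun p x (i : 'I_n) :
  is_derive x (delta_mx 0 i : 'rV[R]_n) (poly_fun p) (poly_fun (mderiv i p) x).
Proof.
pose P p := is_derive x (delta_mx 0 i : 'rV[R]_n) (poly_fun p)
  (poly_fun (mderiv i p) x).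
have PC c : P (mpolyC n c).
  rewrite /P mderivC /poly_fun meval0.
  rewrite (_ : (fun _ => _) = cst c); last by apply/funext => y; rewrite mevalC.
  exact: is_derive_cst.
have PD q1 q2 : P q1 -> P q2 -> P (q1 + q2).
  rewrite /P => hp hq; rewrite mderivD /poly_fun mevalD.
  rewrite (_ : (fun _ => _) = poly_fun q1 + poly_fun q2); last first.
    by apply/funext => y; rewrite mevalD.
  exact: is_deriveD.
have PM q1 q2 : P q1 -> P q2 -> P (q1 * q2).
  rewrite /P => hp hq; rewrite mderivM /poly_fun mevalD.
  rewrite (_ : (fun _ => _) = poly_fun q1 * poly_fun q2); last first.
    by apply/funext => y; rewrite mevalM.
  apply: is_derive_eq; rewrite !mevalM /poly_fun addrC.
  by congr (_ + _); rewrite mulrC.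
have PX j : P 'X_j.
  rewrite /P mderivXU /poly_fun (_ : (fun _ => _) = fun y : 'rV[R]_n => y 0 j);
    last by apply/funext => y; rewrite mevalXU.
  have @f : {linear 'rV[R]_n -> R}.
    by exists (fun y : 'rV[R]_n => y 0 j); do 2![eexists]; do ?[constructor];
      rewrite ?mxE // => ? *; rewrite ?mxE //; move=> ?; rewrite !mxE.
  have fc : continuous f by exact: coord_continuous.
  have fd : differentiable f x by exact: linear_differentiable.
  rewrite -[fun _ => _]/(f : _ -> _); apply: DeriveDef; first exact: diff_derivable.
  rewrite deriveE // diff_lin //= mxE eqxx /=.
  by rewrite raddfMn /= meval1 eq_sym.
rewrite -/(P p) [p]mpolyE; apply: (big_ind P) => // [|m _].
  by rewrite -mpolyC0.
rewrite -mul_mpolyC; apply/PM => //; rewrite mpolyXE_id.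
apply: (big_ind P) => // [|j _]; first by rewrite -mpolyC1.
elim: (m j) => [|k IH]; first by rewrite expr0 -mpolyC1.
by rewrite exprS; exact: PM.
Qed.

Lemma partial_poly_fun p (i : 'I_n) :
  partial i (poly_fun p) = poly_fun (mderiv i p).
Proof.
by apply/funext => x; have h := is_derive_poly_fun p x i; rewrite /partial derive_val.
Qed.
End Derivatives.

(** * The partial derivatives of the perturbation *)
Section XiDerivatives.
Context {R : realType} {n : nat}.
Implicit Types (r : 'I_n -> R) (i j k : 'I_n).

Local Notation "''X_' i" := (mpolyX R (mnm1 i) : {mpoly R[n]})
  (at level 8, i at level 2).

Definition Xi_pair r d i j : {mpoly R[n]} :=
  (4 * r i) *: 'X_i ^+ (2 * d + 1)%N
  + (2 * r j) *: ('X_i ^+ (2 * d)%N * 'X_j)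
  + (2 * r i) *: ('X_i * 'X_j ^+ (2 * d)%N)
  + (4 * r j) *: 'X_j ^+ (2 * d + 1)%N.

Lemma Xi_pairC r d i j : Xi_pair r d i j = Xi_pair r d j i.
Proof. by rewrite /Xi_pair ![_ * 'X_i ^+ _]mulrC ['X_i * _]mulrC; ring. Qed.

Lemma mderiv_Xi_pair0 r d i j k : k != i -> k != j ->
  mderiv k (Xi_pair r d i j) = 0.
Proof.
move=> /negPf ki /negPf kj.
rewrite /Xi_pair !mderivD !mderivZ !mderivM !mderivXn !mderivXU.
rewrite ![_ == k]eq_sym ki kj !(mul0r, mulr0, mul0rn, addr0, scaler0).
by [].
Qed.

(** Only the unordered pairs containing [k] contribute, and the symmetry of [F]
    lets [k] come first in each of them. *)
Lemma sum_pairs_at (V : nmodType) (F : 'I_n -> 'I_n -> V) k :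
  (forall i j, F i j = F j i) ->
  (forall i j, k != i -> k != j -> F i j = 0) ->
  \sum_(i < n) \sum_(j < n | (i < j)%N) F i j = \sum_(j < n | j != k) F k j.
Proof.
move=> FC F0; rewrite (bigD1 k) //= [RHS](bigID (fun j : 'I_n => (k < j)%N)) /=.
congr (_ + _).
  apply: eq_bigl => j; apply/idP/idP => [kj|/andP[]//].
  by rewrite kj andbT; apply: contraTneq kj => ->; rewrite ltnn.
rewrite [RHS]big_mkcondr /=; apply: eq_bigr => i ik.
rewrite -leqNgt leq_eqVlt (negPf (_ : i != k :> nat)) //=.
rewrite big_mkcond (bigD1 k) //= big1 ?addr0 => [|j jk].
  by case: ifP => // _; apply: FC.
by case: ifP => // _; apply: F0; rewrite eq_sym.
Qed.

Lemma mderiv_Xi r d k : mderiv k (Xi r d) =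
  mpolyC n (r k) + \sum_(j < n | j != k) mderiv k (Xi_pair r d k j).
Proof.
rewrite /Xi mderivD; congr (_ + _).
  rewrite raddf_sum (bigD1 k) //= big1 ?addr0 => [|j /negPf jk].
    by rewrite mderivZ mderivXU eqxx -mul_mpolyC mulr1.
  by rewrite mderivZ mderivXU jk scaler0.
rewrite -(@sum_pairs_at _ (fun i j => mderiv k (Xi_pair r d i j))); first last.
- by move=> i j; exact: mderiv_Xi_pair0.
- by move=> i j; rewrite Xi_pairC.
by rewrite raddf_sum; apply: eq_bigr => i _; rewrite raddf_sum.
Qed.

(** With [s = r_k r_j], the multiple [4 d s x^(2 d - 1) y] of the mixed monomial
    is absorbed by the square [d x^(2 d - 2) (2 x + s y)^2]; this leaves a multiple
    of [x^(2 d - 2) y^2], to which the arithmetic-geometric mean inequality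
    applies. *)
Lemma sos_mderiv_Xi_pair r d k j :
  r k ^+ 2 = 1 -> r j ^+ 2 <= 1 -> j != k ->
  sos (r k *: mderiv k (Xi_pair r d.+1 k j) -
       (('X_k ^+ 2) ^+ d.+1 + ('X_j ^+ 2) ^+ d.+1)).
Proof.
move=> rk rj /negPf jk.
set x := 'X_k; set y := 'X_j; set s : {mpoly R[n]} := mpolyC n (r k * r j).
have -> : r k *: mderiv k (Xi_pair r d.+1 k j) =
    (8 * d.+1 + 4)%:R * (x ^+ 2) ^+ d.+1
    + 4 * d.+1%:R * s * ((x ^+ 2) ^+ d * x * y) + 2 * (y ^+ 2) ^+ d.+1.
  rewrite /Xi_pair !mderivD !mderivZ !mderivM !mderivXn !mderivXU.
  rewrite eqxx jk !(mul0r, mulr0, mul0rn, addr0, add0r, scaler0, mul1r).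
  rewrite /s mpolyCM !scalerDr !scalerA -!mul_mpolyC.
  rewrite -!exprM (_ : (2 * d.+1 + 1)%N = (2 * d).+3); last by rewrite mulnS addn1.
  rewrite (_ : (2 * d.+1)%N = (2 * d).+2); last by rewrite mulnS.
  rewrite -/x -/y !succnK !exprS !mpolyCM !rmorph_nat.
  have c2 : mpolyC n (r k) * mpolyC n (r k) = 1.
    by rewrite -mpolyCM -expr2 rk mpolyC1.
  rewrite -!(mulr_natr (_ * _)) !natrD !natrM -!natr1 !natrM; ring: c2.
rewrite (_ : _ - _ =
  d.+1%:R * (x ^+ 2) ^+ d * (2 * x + s * y) ^+ 2 +
  d.+1%:R * (1 - s ^+ 2) * ((x ^+ 2) ^+ d * y ^+ 2) +
  (d%:R * (x ^+ 2) ^+ d.+1 - d.+1%:R * (x ^+ 2) ^+ d * y ^+ 2 + (y ^+ 2) ^+ d.+1)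
  + (3 * d + 7)%:R * (x ^+ 2) ^+ d.+1); last first.
  by rewrite !exprS !natrD !natrM -!natr1; ring.
have sx : sos ((x ^+ 2) ^+ d) by apply/sosX/sos_sqr.
apply: sosD; last by apply: sosM (sos_nat _) (sosX _ _ (sos_sqr _)).
apply: sosD; last by apply: sos_amgm; exact: sos_sqr.
apply: sosD; first by apply: sosM (sos_sqr _); apply: sosM (sos_nat _) _.
apply: sosM; last by apply: sosM (sos_sqr _).
apply: sosM (sos_nat _) _.
have -> : 1 - s ^+ 2 = (1 - r j ^+ 2) *: 1.
  by rewrite /s -rmorphXn /= exprMn rk mul1r -mul_mpolyC mulr1 rmorphB /= mpolyC1.
by apply: sosZ; [rewrite subr_ge0 | exact: sos1].
Qed.

(** Summing over [j != k] gives [x_k^(2 d)] with multiplicity [n - 1], which is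
    positive as soon as there are two variables. *)
Lemma sos_mderiv_Xi r d k : (2 <= n)%N ->
  r k ^+ 2 = 1 -> (forall j, r j ^+ 2 <= 1) ->
  sos (r k *: mderiv k (Xi r d.+1) - even_power_sum d.+1).
Proof.
move=> n2 rk r1; set a := ('X_k ^+ 2) ^+ d.+1.
have -> : r k *: mderiv k (Xi r d.+1) - even_power_sum d.+1 =
    \sum_(j < n | j != k) (r k *: mderiv k (Xi_pair r d.+1 k j) -
      (a + ('X_j ^+ 2) ^+ d.+1)) + a *+ n.-2.
  rewrite /even_power_sum (bigD1 k) //= -/a.
  rewrite mderiv_Xi scalerDr -mul_mpolyC -mpolyCM -expr2 rk mpolyC1.
  rewrite sumrB big_split /= (sumr_const (predC1 k)) cardC1 card_ord.
  rewrite scaler_sumr.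
  have -> : n.-1 = n.-2.+1 by case: n n2 => [|[|m]].
  by rewrite mulrS; ring.
apply: sosD; last exact/sosMn/sosX/sos_sqr.
by apply: sos_sum => j jk; apply: sos_mderiv_Xi_pair.
Qed.

Lemma sos_add_mderiv_Xi r k (g : {mpoly R[n]}) eps : (2 <= n)%N ->
  r k ^+ 2 = 1 -> (forall j, r j ^+ 2 <= 1) -> 0 < eps ->
  (forall x : 'I_n -> R, (forall i, -1 <= x i <= 1) -> 0 <= meval x g) ->
  exists D : nat, forall d, (D <= d)%N ->
    sos (g + (eps * r k) *: mderiv k (Xi r d)).
Proof.
move=> n2 rk r1 eps0 /sos_approx_nonneg ag.
have [D hD] := sos_approx_perturb _ _ ag eps0.
exists (maxn D 1) => -[|d]; rewrite geq_max ?andbF // => /andP[Dd _].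
have -> : g + (eps * r k) *: mderiv k (Xi r d.+1) =
    (g + eps *: even_power_sum d.+1) +
    eps *: (r k *: mderiv k (Xi r d.+1) - even_power_sum d.+1).
  by rewrite scalerBr scalerA; ring.
apply: sosD; first exact: hD.
by apply: sosZ; [exact: ltW | exact: sos_mderiv_Xi].
Qed.

End XiDerivatives.

Lemma unit_box_nonneg {R : realType} {n : nat} (g : {mpoly R[n]}) :
  (forall x, unit_box x -> 0 <= poly_fun g x) ->
  forall x : 'I_n -> R, (forall i, -1 <= x i <= 1) -> 0 <= meval x g.
Proof.
move=> g0 x xB; have := g0 (\row_i x i); rewrite /poly_fun.
have -> : (\row_i x i) 0 = x by apply/funext => i; rewrite mxE.
by apply=> i; rewrite mxE.
Qed.

Theorem theorem3p2 (R : realType) (n : nat) (n_ge2 : (2 <= n)%N)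
    (Km Kp : 'I_n -> \bar R)
    (leK : forall i : 'I_n, (Km i <= Kp i)%E)
    (disjI : [disjoint finite_indices Kp & finite_indices Km])
    (h : {mpoly R[n]})
    (h_bounded : K_bounded_derivatives Km Kp unit_box (poly_fun h))
    (eps : R) (eps_gt0 : 0 < eps) :
  exists d0 : nat, forall d : nat, (d0 <= d)%N ->
    sos_K_bounded_derivatives Km Kp (h + eps *: Xi (rho Km Kp) d).
Proof.
case: h_bounded => _ hm hp.
have r2 j : rho Km Kp j ^+ 2 <= 1 :> R.
  by rewrite /rho; case: ifP => _; [|case: ifP => _];
    rewrite ?sqrrN ?expr1n ?expr0n.
have hmi i : exists D : nat, forall d, (D <= d)%N -> i \in finite_indices Km ->
    sos (mderiv i (h + eps *: Xi (rho Km Kp) d) - mpolyC n (fine (Km i))).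
  case: (boolP (i \in finite_indices Km)) => [iK|]; last by exists 0%N.
  have ri : rho Km Kp i = 1 :> R by rewrite /rho iK.
  have [||D hD] := sos_add_mderiv_Xi (rho Km Kp) i
    (mderiv i h - mpolyC n (fine (Km i))) eps n_ge2 _ r2 eps_gt0.
  - by rewrite ri expr1n.
  - apply: unit_box_nonneg => x xB; have := hm x i xB iK.
    have Kfin : Km i \is a fin_num by move: iK; rewrite inE.
    rewrite partial_poly_fun -{1}(fineK Kfin) lee_fin.
    by rewrite /poly_fun mevalB mevalC subr_ge0.
  exists D => d Dd _; have := hD d Dd.
  by rewrite ri mulr1 mderivD mderivZ addrAC.
have hpi i : exists D : nat, forall d, (D <= d)%N -> i \in finite_indices Kp ->
    sos (mpolyC n (fine (Kp i)) - mderiv i (h + eps *: Xi (rho Km Kp) d)).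
  case: (boolP (i \in finite_indices Kp)) => [iK|]; last by exists 0%N.
  have ri : rho Km Kp i = -1 :> R.
    by rewrite /rho iK (disjointFr disjI iK).
  have [||D hD] := sos_add_mderiv_Xi (rho Km Kp) i
    (mpolyC n (fine (Kp i)) - mderiv i h) eps n_ge2 _ r2 eps_gt0.
  - by rewrite ri sqrrN expr1n.
  - apply: unit_box_nonneg => x xB; have := hp x i xB iK.
    have Kfin : Kp i \is a fin_num by move: iK; rewrite inE.
    rewrite partial_poly_fun -{1}(fineK Kfin) lee_fin.
    by rewrite /poly_fun mevalB mevalC subr_ge0.
  exists D => d Dd _; have := hD d Dd.
  by rewrite ri mulrN1 scaleNr mderivD mderivZ opprD addrA.
have [Dm hDm] := choice hmi; have [Dp hDp] := choice hpi.
exists (maxn (\max_i Dm i) (\max_i Dp i)) => d.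
rewrite geq_max => /andP[md pd]; split=> i iK.
  by apply: hDp => //; apply: leq_trans pd; apply: leq_bigmax.
by apply: hDm => //; apply: leq_trans md; apply: leq_bigmax.
Qed.
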